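(* The following two evaluations hold: $$\mu\big(y^2(x+1)^2+y(x^2+6x+1)+(x+1)^2\big)=\frac{16}{3\pi}\,\mathrm{L}_{-4}(2)=\frac{16}{3\pi}\,\mathrm{G},$$ $$\mu\big(y^2(x+1)^2+y(x^2-10x+1)+(x+1)^2\big)=\frac{5\sqrt3}{\pi}\,\mathrm{L}_{-3}(2)=\frac{20}{3\pi}\,\mathrm{Cl}_2\!\left(\frac{\pi}{3}\right).$$
   Context: For a polynomial $P(x,y)$, the (logarithmic) Mahler measure is $\mu(P)=\int_0^1\int_0^1\log\left|P(e^{2\pi i t},e^{2\pi i u})\right|\,dt\,du$. $\mathrm{L}_{-4}(2)=\sum_{n\ge0}\frac{(-1)^n}{(2n+1)^2}=\mathrm{G}$ is Catalan's constant, and $\mathrm{L}_{-3}(2)=\sum_{n\ge 0}\left(\frac{1}{(3n+1)^2}-\frac1{(3n+2)^2}\right)$ (values at $2$ of the Dirichlet L-series of the primitive quadratic characters of discriminant $-4$ and $-3$). The Clausen function is $\mathrm{Cl}_2(\theta)=\sum_{n=1}^\infty \frac{\sin(n\theta)}{n^2}$. *)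

(* Defs.v *)
From mathcomp Require Import all_boot all_order all_algebra.
From mathcomp Require Import polyXY complex.
From mathcomp Require Import all_classical all_reals all_analysis.

Set Implicit Arguments.
Unset Strict Implicit.
Unset Printing Implicit Defensive.

Import Order.TTheory GRing.Theory Num.Theory.
Import numFieldNormedType.Exports.

Local Open Scope classical_set_scope.
Local Open Scope ring_scope.
Local Open Scope complex_scope.

Definition torus_pt (R : realType) (t : R) : R[i] :=
  cos (2 * pi * t) +i* sin (2 * pi * t).

(* P.[x, y] substitutes x for 'X and y for 'Y = 'X%:P.
   The integrand is -oo at the zeros of P (lne 0 = -oo).  The integral is
   \bar R-valued; since +oo - oo = -oo there, a finite value forces the
   positive and negative parts to have finite integrals. *)
Definition mahler_measure (R : realType) (P : {poly {poly R[i]}}) : \bar R :=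
  (\int[@lebesgue_measure R]_(u in `[0%R, 1%R])
     \int[@lebesgue_measure R]_(t in `[0%R, 1%R])
       lne (complex.Re `|P.[torus_pt t, torus_pt u]|)%:E)%E.

(* L-series of the primitive quadratic character of discriminant -4: only odd
   integers contribute.  Meaningful for s >= 1 only. *)
Definition Lm4 (R : realType) (s : nat) : R :=
  limn (series (fun n => (-1) ^+ n / (2 * n + 1)%:R ^+ s : R)).

(* L-series of the primitive quadratic character of discriminant -3,
   with the terms grouped by consecutive blocks of length 3.
   Meaningful for s >= 1 only. *)
Definition Lm3 (R : realType) (s : nat) : R :=
  limn (series (fun n => 1 / (3 * n + 1)%:R ^+ s - 1 / (3 * n + 2)%:R ^+ s : R)).

Definition catalan (R : realType) : R :=
  limn (series (fun n => (-1) ^+ n / (2 * n + 1)%:R ^+ 2 : R)).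

Definition clausen2 (R : realType) (theta : R) : R :=
  limn (series (fun n => sin (n.+1%:R * theta) / n.+1%:R ^+ 2 : R)).

(* Main.v *)
(* On the torus |x| = |y| = 1 the quotient P(x, y) / (x y) is real of constant
   sign: with x = e^{i theta}, y = e^{i phi} its absolute value is
     (k + 2w)^2 + (k - 2w)^2 - 2 (k + 2w) (k - 2w) cos theta
   where k = 1, w = |cos (phi / 2)| for the first polynomial and k = sqrt 3,
   w = |sin (phi / 2)| for the second.  The integral over theta is therefore
   2 ln (k + 2w).  Writing k = 2 cos g with g = pi / 3, resp. pi / 6,
     (2 cos g + 2 cos psi)^2 =
       (2 - 2 cos (psi + pi - g)) (2 - 2 cos (psi - pi + g)),
   and the expansion ln (2 - 2 cos b) = - 2 sum_n cos (n b) / n, uniform away from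
   b = 0 mod 2 pi, turns the remaining integral into Clausen values, which
   reduce to Catalan's constant, resp. to L_{-3}(2), by grouping terms. *)
Require Import Defs.
From mathcomp Require Import all_boot all_order all_algebra.
From mathcomp Require Import polyXY complex.
From mathcomp Require Import all_classical all_reals all_analysis.
From mathcomp Require Import measurable_realfun.
From mathcomp Require Import ring lra zify.

Set Implicit Arguments.
Unset Strict Implicit.
Unset Printing Implicit Defensive.

Import Order.TTheory GRing.Theory Num.Theory.
Import numFieldNormedType.Exports.

Local Open Scope classical_set_scope.
Local Open Scope ring_scope.

(** * Fourier expansion of the logarithm *)

Section LogSeries.
Context {R : realType}.
Implicit Types (b r s d : R) (N : nat).

(** Truncated expansion of [- Re log (1 - r e^{ib})], that is, of
    [- 1/2 ln (1 - 2 r cos b + r^2)]. *)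
Definition cos_log_sum r b N : R :=
  \sum_(n < N) r ^+ n.+1 * cos (n.+1%:R * b) / n.+1%:R.

(** Real part of the geometric sum of [e^{ib} (s e^{ib})^n], cleared of its denominator
    [|1 - s e^{ib}|^2]. The induction rests on the three-term recurrence for [cos (N b)]. *)
Lemma geometric_cos_sum s b N :
  (1 - 2 * s * cos b + s ^+ 2) * (\sum_(n < N) s ^+ n * cos (n.+1%:R * b)) =
  cos b - s - s ^+ N * cos (N.+1%:R * b) + s ^+ N.+1 * cos (N%:R * b).
Proof.
elim: N => [|N IH]; first by rewrite big_ord0 mulr1n mulr0n mul0r cos0 mul1r; ring.
rewrite big_ord_recr /= mulrDr IH !exprS.
have -> : cos (N.+2%:R * b) = 2 * cos b * cos (N.+1%:R * b) - cos (N%:R * b).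
  rewrite -natr1 mulrDl mul1r cosD.
  have -> : N%:R * b = N.+1%:R * b - b by rewrite -natr1; ring.
  by rewrite cosB; ring.
ring.
Qed.

Lemma is_derive_cos_log_sum b N s :
  is_derive s 1 (fun s => cos_log_sum s b N)
    (\sum_(n < N) s ^+ n * cos (n.+1%:R * b)).
Proof.
rewrite (_ : (fun s => _) = \sum_(n < N)
  (fun s => s ^+ n.+1 * cos (n.+1%:R * b) / n.+1%:R)); last first.
  by apply/funext => x; rewrite fct_sumE.
apply: is_derive_sum => n.
have n0 : n.+1%:R != 0 :> R by rewrite pnatr_eq0.
rewrite (_ : (fun s => _) = (cos (n.+1%:R * b) / n.+1%:R) \*: (@id R ^+ n.+1)).
  by apply: is_derive_eq; rewrite /GRing.scale /= -mulr_natr; field.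
by apply/funext => x /=; rewrite exprfctE /GRing.scale /=; field.
Qed.

(* The difference vanishes at r = 0, and by the geometric sum its derivative at s
   is 2 s^N (s cos (N b) - cos ((N + 1) b)) / (1 - 2 s cos b + s^2). *)
Lemma cos_log_sum_bound r b d N : 0 <= r <= 1 -> 0 < d ->
  (forall s, 0 <= s <= r -> d <= 1 - 2 * s * cos b + s ^+ 2) ->
  `|ln (1 - 2 * r * cos b + r ^+ 2) + 2 * cos_log_sum r b N|
    <= 4 / d / N.+1%:R.
Proof.
move=> /andP[r0 r1] d0 Dge.
pose E s := ln (1 - 2 * s * cos b + s ^+ 2) + 2 * cos_log_sum s b N.
pose dE s := 2 * s ^+ N * (s * cos (N%:R * b) - cos (N.+1%:R * b))
             / (1 - 2 * s * cos b + s ^+ 2).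
have EdE s : 0 <= s <= r -> is_derive s 1 E (dE s).
  move=> s0r; have D0 := lt_le_trans d0 (Dge s s0r).
  have H1 := is_derive1_ln D0.
  have H2 := is_derive_cos_log_sum b N s.
  have H3 : is_derive s 1 (fun s => 1 - 2 * s * cos b + s ^+ 2)
     (2 * s - 2 * cos b).
    rewrite (_ : (fun s => _) = cst 1 + (- 2 * cos b) \*: @id R + @id R ^+ 2).
      by apply: is_derive_eq; rewrite /GRing.scale /= -mulr_natr; ring.
    by apply/funext => x; rewrite !fctE /= /GRing.scale /=; ring.
  have H4 := @is_derive1_comp R (@ln R) (fun s => 1 - 2 * s * cos b + s ^+ 2)
    s _ _ H1 H3.
  rewrite (_ : E = (@ln R \o (fun s => 1 - 2 * s * cos b + s ^+ 2)) +
    2 \*: (fun s => cos_log_sum s b N)); last by apply/funext => x; rewrite !fctE.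
  apply: is_derive_eq; rewrite /GRing.scale /=.
  have := geometric_cos_sum s b N.
  set S := \sum_(n < N) _ => HS.
  apply: (mulfI (lt0r_neq0 D0)); rewrite /dE mulrDr (mulrCA _ 2 S) HS.
  by rewrite !exprS; field; exact: lt0r_neq0.
have dEb s : 0 <= s <= r -> `|dE s| <= 4 / d * s ^+ N.
  move=> /[dup] s0r /andP[s0 sr]; have D0 := lt_le_trans d0 (Dge s s0r).
  rewrite /dE normrM normfV (gtr0_norm D0) !normrM ger0_norm//.
  rewrite (ger0_norm (exprn_ge0 N s0)).
  have c2 : `|s * cos (N%:R * b) - cos (N.+1%:R * b)| <= 2.
    rewrite (le_trans (ler_normB _ _))// (_ : 2 = 1 + 1)// lerD ?cos_max//.
    by rewrite normrM mulr_ile1// ?cos_max// ger0_norm// (le_trans sr).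
  rewrite (_ : 4 / d * s ^+ N = 2 * s ^+ N * 2 / d); last by field; exact: lt0r_neq0.
  apply: ler_pM.
  - by rewrite !mulr_ge0// exprn_ge0.
  - by rewrite invr_ge0 ltW.
  - by rewrite ler_wpM2l// mulr_ge0// exprn_ge0.
  - by rewrite lef_pV2 ?posrE// Dge.
have E0 : E 0 = 0.
  rewrite /E mulr0 mul0r subr0 expr0n addr0 ln1 add0r.
  by rewrite /cos_log_sum big1 ?mulr0// => n _; rewrite exprS !mul0r.
(* The signs [e = 1] and [e = -1] give the two halves of the absolute value. The added term is the
   antiderivative of the bound on [|dE s|], so [f] vanishes at 0 and has nonnegative derivative. *)
have key (e : R) : `|e| = 1 -> 0 <= 4 / d / N.+1%:R * r ^+ N.+1 + e * E r.
  move=> e1.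
  pose f s := 4 / d / N.+1%:R * s ^+ N.+1 + e * E s.
  have fd s : 0 <= s <= r -> is_derive s 1 f (4 / d * s ^+ N + e * dE s).
    move=> s0r; have H := EdE s s0r.
    rewrite (_ : f = (4 / d / N.+1%:R) \*: (@id R ^+ N.+1) + e \*: E); last first.
      by apply/funext => x; rewrite !fctE.
    apply: is_derive_eq; rewrite /GRing.scale /= -mulr_natr.
    by field; rewrite addrC natr1 pnatr_eq0 lt0r_neq0.
  have [||c cr] := @MVT_segment R f (fun s => 4 / d * s ^+ N + e * dE s) 0 r r0.
  - by move=> x; rewrite in_itv/= => /andP[x0 xr]; apply: fd; rewrite !ltW.
  - apply/continuous_in_subspaceT => x; rewrite inE/= in_itv/= => xr.
    by have [+ _] := fd x xr => /derivable1_diffP/differentiable_continuous.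
  rewrite /f E0 expr0n /= !mulr0 addr0 !subr0 => ->.
  rewrite mulr_ge0//; move: cr; rewrite in_itv/= => cr.
  have := dEb _ cr; rewrite -(mul1r `|dE c|) -e1 -normrM ler_norml => /andP[h _].
  by rewrite addrC -lerBlDr sub0r.
have rN : 4 / d / N.+1%:R * r ^+ N.+1 <= 4 / d / N.+1%:R.
  by rewrite ler_piMr ?exprn_ile1// !mulr_ge0// invr_ge0 ?ltW.
have h1 := key 1 (normr1 _); have h2 := key (-1) (normrN1 _).
move: rN h1 h2; rewrite ler_norml -/(E r) mul1r mulN1r subr_ge0.
move=> XY h1 h2; rewrite (le_trans h2 XY) andbT lerNl (le_trans _ XY)//.
by rewrite -subr_ge0 opprK.
Qed.

End LogSeries.

(** * Termwise integration *)

Section IntegralSeries.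
Context {R : realType}.
Implicit Types (a b d e k m r t x : R) (N : nat).
Notation mu := (@lebesgue_measure R).

Lemma integrable_continuous_itv (f : R -> R) a b :
  {in `[a, b], continuous f} -> mu.-integrable `[a, b] (EFin \o f).
Proof.
move=> cf; apply: continuous_compact_integrable; first exact: segment_compact.
by apply/continuous_in_subspaceT => x; rewrite inE; exact: cf.
Qed.

(** By the fundamental theorem of calculus [G b - G a] is the integral of [g], so a uniform error
    bound only has to be integrated. Here [f] will be a logarithm and [g] a truncation of its
    Fourier series. *)
Lemma Rintegral_approx (f g G : R -> R) a b e : a < b ->
  {in `[a, b], continuous f} -> continuous g ->
  (forall x, is_derive x 1 G (g x)) ->
  {in `[a, b], forall x, `|f x - g x| <= e} ->
  `|\int[mu]_(x in `[a, b]) f x - (G b - G a)| <= e * (b - a).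
Proof.
move=> ab cf cg dG fg.
have cG : continuous G.
  by move=> x; have [+ _] := dG x => /derivable1_diffP/differentiable_continuous.
have intf := integrable_continuous_itv cf.
have intg : mu.-integrable `[a, b] (EFin \o g).
  by apply: integrable_continuous_itv => x _; exact: cg.
have -> : G b - G a = \int[mu]_(x in `[a, b]) g x.
  rewrite /Rintegral (@continuous_FTC2 _ g G)//.
  - exact: continuous_subspaceT.
  - split.
    + by move=> x _; have [] := dG x.
    + exact/cvg_at_right_filter/cG.
    + exact/cvg_at_left_filter/cG.
  - by move=> x _; rewrite derive1E; have [_ ->] := dG x.
rewrite -RintegralB//.
have cfg : {in `[a, b], continuous (f \- g)}.
  by move=> x xab; apply: cvgB; [exact: cf | exact: cg].
apply: (le_trans (le_normr_Rintegral _ (integrable_continuous_itv cfg))) => //.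
have -> : e * (b - a) = \int[mu]_(x in `[a, b]) e.
  by rewrite Rintegral_cst//= lebesgue_measure_itv/= lte_fin ab.
apply: le_Rintegral => //.
- apply: (@integrable_continuous_itv (fun x => `|f x - g x|)) => x xab.
  by apply: cvg_norm; exact: cfg.
- by apply: integrable_continuous_itv => x _; exact: cvg_cst.
Qed.

(** Termwise antiderivative of [cos_log_sum] in the angle; at [r = 1] it is a truncated Clausen
    series. *)
Definition sin_log_sum r x N : R :=
  \sum_(n < N) r ^+ n.+1 * sin (n.+1%:R * x) / n.+1%:R ^+ 2.

Lemma is_derive_affine k m t : is_derive t 1 (fun t => k * t + m) k.
Proof.
rewrite (_ : (fun t => _) = k \*: @id R + cst m).
  by apply: is_derive_eq; rewrite /GRing.scale /=; ring.
by apply/funext => x; rewrite !fctE.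
Qed.

Lemma is_derive_sin_log_sum r k m N t : k != 0 ->
  is_derive t 1 (fun t => sin_log_sum r (k * t + m) N / k)
    (cos_log_sum r (k * t + m) N).
Proof.
move=> k0; rewrite (_ : (fun t => _) = \sum_(n < N)
  (r ^+ n.+1 / n.+1%:R ^+ 2 / k) \*: (@sin R \o (fun t => n.+1%:R * k * t + n.+1%:R * m))).
  apply: is_derive_sum => n.
  have n0 : n.+1%:R != 0 :> R by rewrite pnatr_eq0.
  have H := is_derive_affine (n.+1%:R * k) (n.+1%:R * m) t.
  apply: is_derive_eq; rewrite /GRing.scale /=.
  rewrite mulrDr (mulrA n.+1%:R k t); field.
  by rewrite k0 addrC natr1 n0.
apply/funext => x; rewrite fct_sumE /sin_log_sum mulr_suml; apply: eq_bigr => n _.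
by rewrite !fctE /= /GRing.scale /= mulrDr (mulrA n.+1%:R k x); ring.
Qed.

Lemma continuous_cos_log_sum r k m N :
  continuous (fun t => cos_log_sum r (k * t + m) N).
Proof.
apply: (continuous_big (op := +%R) (x0 := 0)) => [|n _ t]; first exact: add_continuous.

apply: cvgMr_tmp; apply: cvgMl_tmp; apply: continuous_comp; last exact: continuous_cos.
apply: cvgMl_tmp; apply: cvgD; last exact: cvg_cst.
by apply: cvgMl_tmp; exact: cvg_id.
Qed.

Lemma continuous_ln_cos r k m t : 0 < 1 - 2 * r * cos (k * t + m) + r ^+ 2 ->
  {for t, continuous (fun t => ln (1 - 2 * r * cos (k * t + m) + r ^+ 2))}.
Proof.
move=> D0; apply: continuous_comp; last exact: continuous_ln.
apply: cvgD; last exact: cvg_cst.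
apply: cvgB; first exact: cvg_cst.
apply: cvgMl_tmp; apply: continuous_comp; last exact: continuous_cos.
apply: cvgD; last exact: cvg_cst.
by apply: cvgMl_tmp; exact: cvg_id.
Qed.

(** The number [d] bounds [|1 - s e^{i(kt+m)}|^2] from below for all [s] up to [r], uniformly in
    [t]. The truncation error is then at most [4 / d / N.+1%:R] on the whole interval, and its
    integral tends to 0. The value [r = 1] is allowed as long as the angle avoids the multiples of 2
    pi. *)
Lemma cvg_sin_log_sum a b k m r d : a < b -> k != 0 -> 0 <= r <= 1 -> 0 < d ->
  {in `[a, b], forall t s, 0 <= s <= r ->
     d <= 1 - 2 * s * cos (k * t + m) + s ^+ 2} ->
  (fun N => - 2 / k * (sin_log_sum r (k * b + m) N - sin_log_sum r (k * a + m) N))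
    @ \oo --> \int[mu]_(t in `[a, b]) ln (1 - 2 * r * cos (k * t + m) + r ^+ 2).
Proof.
move=> ab k0 r01 d0 H.
have rr : 0 <= r <= r by case/andP: r01 => -> _ /=.
apply/cvgrPdist_le => e e0.
have c0 : 0 < 4 / d * (b - a) by rewrite mulr_gt0 ?subr_gt0// divr_gt0.
have : 4 / d * (b - a) * @harmonic R N @[N --> \oo] --> 4 / d * (b - a) * 0.
  by apply: cvgMl_tmp; exact: cvg_harmonic.
rewrite mulr0 => /cvgrPdist_le /(_ _ e0); apply: filterS => N.
rewrite sub0r normrN => HN; apply: le_trans (le_trans (ler_norm _) HN).
have -> : 4 / d * (b - a) * harmonic N = 4 / d / N.+1%:R * (b - a) :> R.
  by rewrite /harmonic /=; ring.
pose g t := - 2 * cos_log_sum r (k * t + m) N.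
pose G t := - 2 * (sin_log_sum r (k * t + m) N / k).
have -> : - 2 / k * (sin_log_sum r (k * b + m) N - sin_log_sum r (k * a + m) N)
  = G b - G a by rewrite /G; ring.
apply: (@Rintegral_approx _ g) => //.
- move=> t tab; apply: continuous_ln_cos.
  by rewrite (lt_le_trans d0)// H.
- by move=> t; apply: cvgMl_tmp; exact: continuous_cos_log_sum.
- move=> t; have K := is_derive_sin_log_sum r m N t k0.
  rewrite (_ : G = - 2 \*: (fun t => sin_log_sum r (k * t + m) N / k)).
    by apply: is_derive_eq; rewrite /GRing.scale.
  by apply/funext.
- move=> t tab; rewrite /g mulNr opprK.
  by apply: cos_log_sum_bound => //; exact: H.
Qed.

End IntegralSeries.

(** * Integrals of logarithms of trigonometric functions *)

Section LogTrigIntegrals.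
Context {R : realType}.
Implicit Types (a b c g k m r s t w x : R) (n N : nat).
Notation mu := (@lebesgue_measure R).

Lemma cosD2pin x n : cos (x + pi *+ 2 *+ n) = cos x :> R.
Proof. exact: (periodicn (@cosD2pi R)). Qed.

Lemma sinD2pin x n : sin (x + pi *+ 2 *+ n) = sin x :> R.
Proof. exact: (periodicn (@sinD2pi R)). Qed.

(* A negative r is made positive by the shift t |-> t + 1/2. *)
Lemma Rintegral_ln_poisson r : `|r| < 1 ->
  \int[mu]_(t in `[0, 1]) ln (1 - 2 * r * cos (2 * pi * t) + r ^+ 2) = 0.
Proof.
move=> r1; pose m : R := if r < 0 then pi else 0.
have rm t : 2 * r * cos (2 * pi * t) = 2 * `|r| * cos (2 * pi * t + m).
  rewrite /m; case: ltP => r0; last by rewrite addr0 ger0_norm.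
  by rewrite ltr0_norm// cosDpi; ring.
under eq_Rintegral do rewrite rm -(real_normK (num_real r)).
have k0 : 2 * pi != 0 :> R by rewrite mulf_neq0// gt_eqF// pi_gt0.
(* This is the lower bound [d]: [|1 - s e^{ib}| >= 1 - s >= 1 - |r|]. *)
have d0 : 0 < (1 - `|r|) ^+ 2 by rewrite exprn_gt0// subr_gt0.
have H : {in `[0, 1 : R], forall t s, 0 <= s <= `|r| ->
    (1 - `|r|) ^+ 2 <= 1 - 2 * s * cos (2 * pi * t + m) + s ^+ 2}.
  move=> t _ s /andP[s0 sr]; have c1 := cos_le1 (2 * pi * t + m); nra.
have r01 : 0 <= `|r| <= 1 by rewrite normr_ge0 ltW.
have := cvg_sin_log_sum ltr01 k0 r01 d0 H.
(* The angles at the two endpoints differ by 2 pi, so every approximant is exactly 0. *)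
rewrite (_ : (fun N => _) = cst 0).
  by move=> /(cvg_lim (@Rhausdorff R)) <-; rewrite lim_cst.
apply/funext => N; rewrite [sin_log_sum _ (_ + m) N](_ : _ = sin_log_sum `|r| m N).
  by rewrite mulr0 add0r subrr mulr0.
apply: eq_bigr => n _; congr (_ * _ / _).
rewrite mulr1 mulrDr addrC (_ : _ * (2 * pi) = pi *+ 2 *+ n.+1) ?sinD2pin//.
by rewrite -[_ *+ n.+1]mulr_natr -[pi *+ 2]mulr_natr; ring.
Qed.

Lemma poisson_factor k w x : 0 < k -> 0 < w ->
  (k + 2 * w) ^+ 2 + (k - 2 * w) ^+ 2 - 2 * (k + 2 * w) * (k - 2 * w) * x =
  (k + 2 * w) ^+ 2 *
  (1 - 2 * ((k - 2 * w) / (k + 2 * w)) * x + ((k - 2 * w) / (k + 2 * w)) ^+ 2).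
Proof. by move=> k0 w0; field; apply/lt0r_neq0; lra. Qed.

Lemma poisson_ratio k w : 0 < k -> 0 < w -> `|(k - 2 * w) / (k + 2 * w)| < 1.
Proof.
move=> k0 w0; have kw : 0 < k + 2 * w by lra.
rewrite normrM normfV (gtr0_norm kw) ltr_pdivrMr// mul1r ltr_norml.
by apply/andP; split; lra.
Qed.

Lemma poisson_gt0 r x : `|r| < 1 -> `|x| <= 1 -> 0 < 1 - 2 * r * x + r ^+ 2.
Proof.
rewrite ltr_norml ler_norml => /andP[r1 r2] /andP[x1 x2].
by case: (lerP 0 r) => r0; nra.
Qed.

(** Jensen's formula: with [A = k + 2 w] and [B = k - 2 w] the argument of the logarithm is
    [|A - B e^{i theta}|^2]. Since [|B| < A], factoring out [A^2] leaves a logarithm of mean 0. *)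
Lemma integral_lne_poisson k w : 0 < k -> 0 < w ->
  (\int[mu]_(t in `[0%R, 1%R]) lne (((k + 2 * w) ^+ 2 + (k - 2 * w) ^+ 2
    - 2 * (k + 2 * w) * (k - 2 * w) * cos (2 * pi * t))%:E))%E
  = (2 * ln (k + 2 * w))%:E.
Proof.
move=> k0 w0; set r := (k - 2 * w) / (k + 2 * w).
have r1 : `|r| < 1 := poisson_ratio k0 w0.
have A0 : 0 < k + 2 * w by lra.
have D0 t := poisson_gt0 r1 (cos_max (2 * pi * t)).
pose f t := ln (1 - 2 * r * cos (2 * pi * t) + r ^+ 2).
have cf : {in `[0, 1], continuous f}.
  have -> : f = fun t => ln (1 - 2 * r * cos (2 * pi * t + 0) + r ^+ 2).
    by apply/funext => t; rewrite addr0.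
  by move=> t _; apply: continuous_ln_cos; rewrite addr0.
have cg : {in `[0, 1], continuous (cst (2 * ln (k + 2 * w)) : R -> R)}.
  by move=> t _; exact: cvg_cst.
have intf := integrable_continuous_itv cf.
have intg := integrable_continuous_itv cg.
transitivity (\int[mu]_(t in `[0%R, 1%R])
    ((cst (2 * ln (k + 2 * w)) t)%:E + (f t)%:E))%E.
  apply: eq_integral => t _.
  rewrite poisson_factor// lne_EFin ?mulr_gt0 ?exprn_gt0 ?D0//.
  by rewrite lnM ?posrE ?exprn_gt0 ?D0// lnXn// -[ln _ *+ 2]mulr_natl EFinD.
rewrite (integralD _ intg intf)//=.
have fE : (\int[mu]_(t in `[0%R, 1%R]) (f t)%:E)%E \is a fin_num.
  exact: integrable_fin_num.
rewrite -(fineK fE) [fine _](Rintegral_ln_poisson r1).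
rewrite adde0 integral_cst//= lebesgue_measure_itv/= lte_fin ltr01.
by rewrite oppr0 adde0 mule1.
Qed.

(** * Truncated Clausen series and the integrals they evaluate *)

Definition clausen_sum x N : R := sin_log_sum 1 x N.

Lemma clausen_sumE x : clausen_sum x =
  series (fun n => sin (n.+1%:R * x) / n.+1%:R ^+ 2).
Proof.
apply/funext => N; rewrite /series /= big_mkord; apply: eq_bigr => n _.
by rewrite expr1n mul1r.
Qed.

Lemma clausen_sumN x N : clausen_sum (- x) N = - clausen_sum x N.
Proof.
by rewrite -sumrN; apply: eq_bigr => n _; rewrite mulrN sinN mulrN mulNr.
Qed.

Lemma clausen_sumD2pi x N : clausen_sum (x + pi *+ 2) N = clausen_sum x N.
Proof.
apply: eq_bigr => n _; congr (_ * _ / _).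
by rewrite mulrDr [_ * (pi *+ 2)]mulr_natl sinD2pin.
Qed.

(** Follows from [1 - 2 s c + s^2 = (s - c)^2 + (1 - c) + c (1 - c)]. It supplies the constant [d]
    up to radius 1, once the cosine of the angle stays below some [c < 1]. *)
Lemma unit_circle_dist_ge c b s : 0 <= c <= 1 -> cos b <= c -> 0 <= s ->
  1 - c <= 1 - 2 * s * cos b + s ^+ 2.
Proof.
move=> /andP[c0 c1] bc s0; have h1 := sqr_ge0 (s - c).
have h2 := ler_wpM2l s0 bc.
have h3 : 0 <= c * (1 - c) by rewrite mulr_ge0// subr_ge0.
nra.
Qed.

(** Makes the [limn] in [clausen2] a genuine limit. Convergence is read off from [cvg_sin_log_sum]
    on [[x, pi]] with [r = 1]: the endpoint [pi] contributes 0, which leaves twice the partial sums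
    at [x]. *)
Lemma cvg_clausen_sum x : 0 < x < pi -> clausen_sum x @ \oo --> clausen2 x.
Proof.
move=> /andP[x0 xpi]; rewrite /clausen2 -clausen_sumE.
have c1 : cos x < 1.
  by rewrite -cos0 ltr_cos// in_itv/= ?lexx ?pi_ge0 ?ltW.
(* The cosine decreases on [[x, pi]], so [cos x] bounds it; the maximum with 0 meets the condition
   [0 <= c] of [unit_circle_dist_ge]. *)
have d0 : 0 < 1 - Num.max 0 (cos x) by rewrite subr_gt0 gt_max ltr01 c1.
have H : {in `[x, pi], forall t s, 0 <= s <= 1 ->
    1 - Num.max 0 (cos x) <= 1 - 2 * s * cos (1 * t + 0) + s ^+ 2}.
  move=> t; rewrite in_itv/= => /andP[xt tpi] s /andP[s0 _].
  apply: unit_circle_dist_ge => //.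
    by rewrite le_max lexx/= ge_max ler01 ltW.
  rewrite le_max; apply/orP; right.
  have xI : x \in `[0, pi] by rewrite in_itv/= !ltW.
  have tI : t \in `[0, pi] by rewrite in_itv/= tpi (le_trans (ltW x0)).
  by rewrite mul1r addr0 leNgt ltr_cos// -leNgt.
have r01 : 0 <= (1 : R) <= 1 by rewrite ler01 lexx.
have /cvgP := cvg_sin_log_sum xpi (oner_neq0 R) r01 d0 H.
have -> : (fun N => - 2 / 1 * (sin_log_sum 1 (1 * pi + 0) N
    - sin_log_sum 1 (1 * x + 0) N)) = (fun N => 2 * clausen_sum x N).
  apply/funext => N; rewrite !mul1r !addr0 /clausen_sum.
  rewrite [sin_log_sum 1 pi N]big1 ?sub0r; first by field.
  move=> n _; rewrite mulr_natl -[pi *+ _]add0r (alternatingn (@sinDpi R)) sin0.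
  by rewrite !mulr0 mul0r.
move=> H2; have -> : clausen_sum x = (fun N => 2^-1 * (2 * clausen_sum x N)).
  by apply/funext => N; rewrite mulrA mulVf ?mul1r// pnatr_eq0.
apply: is_cvgMl_tmp; exact: H2.
Qed.

(** The shifts [m + (pi - g)] and [m - (pi - g)] come from the two factors of
    [(2 cos g + 2 cos psi)^2], where [psi = pi t + m]. The bounds on [a] and [b] keep [psi] in
    [[- pi/2, pi/2]], so [cos psi >= 0] and both logarithms stay away from their singularity. *)
Lemma cvg_ln_cos_cos g m a b : a < b -> 0 < g < pi / 2 ->
  - (pi / 2) <= pi * a + m -> pi * b + m <= pi / 2 ->
  - 2 / pi * (clausen_sum (pi * b + (m + (pi - g))) N
              - clausen_sum (pi * a + (m + (pi - g))) N)
  + - 2 / pi * (clausen_sum (pi * b + (m - (pi - g))) N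
              - clausen_sum (pi * a + (m - (pi - g))) N) @[N --> \oo]
  --> \int[mu]_(t in `[a, b]) (2 * ln (2 * cos g + 2 * cos (pi * t + m))).
Proof.
move=> ab /andP[g0 g2] am bm.
have pi0 : pi != 0 :> R by rewrite gt_eqF// pi_gt0.
have pig := pi_gt0 R.
have cg0 : 0 < cos g by apply: cos_gt0_pihalf; apply/andP; split; lra.
have sg0 : 0 < sin g by apply: sin_gt0_pihalf; apply/andP; split; lra.
have sg1 : sin g < 1.
  by have := cos2Dsin2 g; nra.
have d0 : 0 < 1 - sin g by rewrite subr_gt0.
have tcos : {in `[a, b], forall t, 0 <= cos (pi * t + m)}.
  move=> t; rewrite in_itv/= => /andP[at_ tb]; apply: cos_ge0_pihalf.
  have := ler_wpM2l (ltW pig) at_; have := ler_wpM2l (ltW pig) tb => h1 h2.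
  by apply/andP; split; lra.
have c1 t : cos (pi * t + (m + (pi - g))) = - cos (pi * t + m - g).
  by rewrite -cosDpi; congr cos; ring.
have c2 t : cos (pi * t + (m - (pi - g))) = - cos (pi * t + m + g).
  by rewrite -[LHS]opprK -cosDpi; congr (- cos _); ring.
(* [- cos (psi - g) = - cos psi cos g - sin psi sin g <= sin g], both cosines being nonnegative;
   [b2] is the mirror image. *)
have b1 : {in `[a, b], forall t, cos (pi * t + (m + (pi - g))) <= sin g}.
  move=> t /tcos h; rewrite c1 (cosB (pi * t + m)).
  have := sin_geN1 (pi * t + m); have := sin_le1 (pi * t + m); nra.
have b2 : {in `[a, b], forall t, cos (pi * t + (m - (pi - g))) <= sin g}.
  move=> t /tcos h; rewrite c2 (cosD (pi * t + m)).
  have := sin_geN1 (pi * t + m); have := sin_le1 (pi * t + m); nra.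
have r01 : 0 <= (1 : R) <= 1 by rewrite ler01 lexx.
have H1 : {in `[a, b], forall t s, 0 <= s <= 1 ->
    1 - sin g <= 1 - 2 * s * cos (pi * t + (m + (pi - g))) + s ^+ 2}.
  move=> t tab s /andP[s0 _].
  by apply: unit_circle_dist_ge => //; [rewrite !ltW|exact: b1].
have H2 : {in `[a, b], forall t s, 0 <= s <= 1 ->
    1 - sin g <= 1 - 2 * s * cos (pi * t + (m - (pi - g))) + s ^+ 2}.
  move=> t tab s /andP[s0 _].
  by apply: unit_circle_dist_ge => //; [rewrite !ltW|exact: b2].
have := cvgD (cvg_sin_log_sum ab pi0 r01 d0 H1) (cvg_sin_log_sum ab pi0 r01 d0 H2).
rewrite -RintegralD//; first last.
- apply: integrable_continuous_itv => t tab; apply: continuous_ln_cos.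
  by apply: lt_le_trans d0 _; apply: H2 => //; rewrite ler01 lexx.
- apply: integrable_continuous_itv => t tab; apply: continuous_ln_cos.
  by apply: lt_le_trans d0 _; apply: H1 => //; rewrite ler01 lexx.
move=> H; rewrite [X in _ --> X](_ : _ = \int[mu]_(t in `[a, b])
  (ln (1 - 2 * 1 * cos (pi * t + (m + (pi - g))) + 1 ^+ 2) +
   ln (1 - 2 * 1 * cos (pi * t + (m - (pi - g))) + 1 ^+ 2))).
  exact: H.
apply: eq_Rintegral => t; rewrite inE => tab.
rewrite -lnM ?posrE; first last.
- by apply: lt_le_trans d0 _; apply: H2 => //; rewrite ler01 lexx.
- by apply: lt_le_trans d0 _; apply: H1 => //; rewrite ler01 lexx.
have h := tcos _ tab.
have -> : 2 * ln (2 * cos g + 2 * cos (pi * t + m)) =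
   ln ((2 * cos g + 2 * cos (pi * t + m)) ^+ 2).
  by rewrite lnXn ?mulr_natl//; lra.
congr ln; rewrite c1 c2 (cosB (pi * t + m)) (cosD (pi * t + m)).
have E1 := cos2Dsin2 g; have E2 := cos2Dsin2 (pi * t + m).
rewrite expr1n mulr1.
move: (cos g) (sin g) (cos (pi * t + m)) (sin (pi * t + m)) E1 E2 => x y z u E1 E2.
(* This is the product of the two factors [2 + 2 (z x + u y)] and [2 + 2 (z x - u y)]. Replacing
   [u^2] and [y^2] through the Pythagorean identity turns it into [4 (x + z)^2]. *)
transitivity (4 * ((1 + z * x) ^+ 2 - u ^+ 2 * y ^+ 2)); last by ring.
have -> : y ^+ 2 = 1 - x ^+ 2 by rewrite -E1; ring.
have -> : u ^+ 2 = 1 - z ^+ 2 by rewrite -E2; ring.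
ring.
Qed.

End LogTrigIntegrals.

(** * Special values of the Clausen function *)

Section ClausenValues.
Context {R : realType}.
Implicit Types (x : R) (n N : nat).

(** * Sines and cosines of pi/3 and pi/6 *)

Lemma cos_pi3 : cos (pi / 3) = 1 / 2 :> R.
Proof.
have pig := pi_gt0 R.
have c0 : 0 < cos (pi / 3 : R).
  by apply: cos_gt0_pihalf; apply/andP; split; lra.
(* Twice pi/3 is its own supplement, which gives a quadratic equation for the cosine with only one
   positive root. *)
have E1 : cos (pi / 3 + pi / 3) = - cos (pi / 3 : R).
  by rewrite -[cos (pi / 3) in RHS]cosN -cosDpi; congr cos; field.
have := cos2Dsin2 (pi / 3 : R); move: E1; rewrite cosD.
move: (cos (pi / 3 : R)) (sin (pi / 3 : R)) c0 => c s c0 h1 h2.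
have : (2 * c - 1) * (c + 1) = 0 by lra.
by move/eqP; rewrite mulf_eq0 => /orP[] /eqP; lra.
Qed.

Lemma sin_pi3 : sin (pi / 3) = Num.sqrt 3 / 2 :> R.
Proof.
have pig := pi_gt0 R.
have s0 : 0 < sin (pi / 3 : R) by apply: sin_gt0_pi; apply/andP; split; lra.
have := cos2Dsin2 (pi / 3 : R); rewrite cos_pi3 => h.
have -> : Num.sqrt 3 = Num.sqrt ((2 * sin (pi / 3 : R)) ^+ 2).
  by congr Num.sqrt; lra.
by rewrite sqrtr_sqr gtr0_norm ?mulr_gt0//; field.
Qed.

Lemma sin_pi6 : sin (pi / 6) = 1 / 2 :> R.
Proof. by rewrite -cos_pi3 -cosBpihalf -cosN; congr cos; field. Qed.

Lemma cos_pi6 : cos (pi / 6) = Num.sqrt 3 / 2 :> R.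
Proof. by rewrite -sin_pi3 -cosN -sinDpihalf; congr sin; field. Qed.

(** * Exact identities between truncated series, and their limits along subsequences *)

Lemma cvg_seq_muln (u : nat -> R) (l : R) k : (0 < k)%N -> u @ \oo --> l ->
  u (k * N)%N @[N --> \oo] --> l.
Proof.
move=> k0 ul; apply: (cvg_comp (fun N => (k * N)%N) u _ ul).
move=> A [M _ HM]; exists M => // n /= Mn; apply: HM => /=.
by rewrite (leq_trans Mn)// leq_pmull.
Qed.

Lemma sin_alternating_pi x n : sin (x + pi *+ n) = (- 1) ^+ n * sin x.
Proof. exact: (alternatingn (@sinDpi R)). Qed.

Lemma sin_mul_reflect x n : sin (n%:R * (pi - x)) = - (- 1) ^+ n * sin (n%:R * x).
Proof.
rewrite mulrBr addrC [n%:R * pi]mulr_natl sin_alternating_pi sinN.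
by rewrite mulrN mulNr.
Qed.

Lemma clausen_sum_recr x N : clausen_sum x N.+1 =
  clausen_sum x N + sin (N.+1%:R * x) / N.+1%:R ^+ 2.
Proof. by rewrite /clausen_sum /sin_log_sum big_ord_recr /= expr1n mul1r. Qed.

Lemma clausen_sum0 x : clausen_sum x 0 = 0.
Proof. by rewrite /clausen_sum /sin_log_sum big_ord0. Qed.

(** Reflecting [x] to [pi - x] flips the sign of the even-index terms only. The difference thus
    keeps twice those terms, and [2 / (2 j)^2 = 1 / (2 j^2)]. *)
Lemma clausen_sum_duplication x N :
  clausen_sum x (2 * N) - clausen_sum (pi - x) (2 * N) =
  2^-1 * clausen_sum (2 * x) N.
Proof.
elim: N => [|N IH]; first by rewrite muln0 !clausen_sum0 subrr mulr0.
rewrite (_ : (2 * N.+1 = (2 * N).+2)%N); last by rewrite mulnS.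
rewrite !clausen_sum_recr !sin_mul_reflect mulrDr -IH.
have -> : (- 1) ^+ (2 * N).+1 = - 1 :> R.
  by rewrite exprS exprM sqrrN expr1n expr1n mulr1.
have -> : (- 1) ^+ (2 * N).+2 = 1 :> R.
  by rewrite !exprS exprM sqrrN expr1n expr1n !mulN1r opprK.
have -> : N.+1%:R * (2 * x) = (2 * N).+2%:R * x.
  by rewrite mulrA -natrM mulnC mulnS.
have -> : (2 * N).+2%:R = 2 * N.+1%:R :> R by rewrite -natrM mulnS.
field; rewrite -?natrM ?natr1 ?nat1r ?pnatr_eq0//.
Qed.

(** The same reflection, added instead of subtracted, keeps twice the odd-index terms. *)
Lemma clausen_sum_odd x N :
  clausen_sum x (2 * N) + clausen_sum (pi - x) (2 * N) =
  2 * series (fun n => sin ((2 * n).+1%:R * x) / (2 * n).+1%:R ^+ 2) N.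
Proof.
elim: N => [|N IH].
  by rewrite muln0 !clausen_sum0 /series /= big_geq// addr0 mulr0.
rewrite (_ : (2 * N.+1 = (2 * N).+2)%N); last by rewrite mulnS.
rewrite !clausen_sum_recr !sin_mul_reflect.
rewrite /series /= big_nat_recr//= mulrDr -[X in _ = X + _]IH.
have -> : (- 1) ^+ (2 * N).+1 = - 1 :> R.
  by rewrite exprS exprM sqrrN expr1n expr1n mulr1.
have -> : (- 1) ^+ (2 * N).+2 = 1 :> R.
  by rewrite !exprS exprM sqrrN expr1n expr1n !mulN1r opprK.
ring.
Qed.

Definition catalan_sum N : R :=
  series (fun n => (- 1) ^+ n / (2 * n + 1)%:R ^+ 2 : R) N.

(** The angle [pi / 2] is fixed by the reflection, so only odd indices survive, with alternating
    sines. Convergence of the Catalan series is inherited from this. *)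
Lemma catalan_sumE N : catalan_sum N = clausen_sum (pi / 2) (2 * N).
Proof.
have := clausen_sum_odd (pi / 2) N.
have -> : pi - pi / 2 = pi / 2 :> R by field.
have n2 : 2 != 0 :> R by rewrite pnatr_eq0.
rewrite -mulr2n -[_ *+ 2]mulr_natl => /(mulfI n2) ->.
apply: eq_bigr => n _; rewrite addn1; congr (_ / _).
have -> : (2 * n).+1%:R * (pi / 2) = pi / 2 + pi *+ n :> R.
  by rewrite -natr1 natrM -[pi *+ n]mulr_natl; field.
by rewrite sin_alternating_pi sin_pihalf mulr1.
Qed.

Lemma cvg_catalan_sum : catalan_sum @ \oo --> catalan R.
Proof.
have H : catalan_sum @ \oo --> clausen2 (pi / 2 : R).
  rewrite (_ : catalan_sum = fun N => clausen_sum (pi / 2) (2 * N)).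
    apply: cvg_seq_muln => //.
    by have pig := pi_gt0 R; apply: cvg_clausen_sum; apply/andP; split; lra.
  by apply/funext => N; exact: catalan_sumE.
by have <- : clausen2 (pi / 2 : R) = catalan R
  by rewrite -(cvg_lim (@Rhausdorff R) H).
Qed.

Lemma natr_affine m n p : (m * n + p)%:R = m%:R * n%:R + p%:R :> R.
Proof. by rewrite natrD natrM. Qed.

(** At the odd indices 6N+1, 6N+3, 6N+5 twice the sine is [(-1)^N] times (1, 2, 1), whereas
    Catalan's signs there are [(-1)^N] times (1, -1, 1). The excess (0, 3, 0) gives
    [3 / (6N+3)^2 = 1/3 / (2N+1)^2], a third of Catalan's series again. *)
Lemma clausen_sum_catalan N :
  clausen_sum (pi / 6) (2 * (3 * N)) + clausen_sum (pi - pi / 6) (2 * (3 * N)) =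
  catalan_sum (3 * N) + catalan_sum N / 3.
Proof.
rewrite clausen_sum_odd; elim: N => [|N IH].
  by rewrite muln0 /catalan_sum /series /= !big_geq// mulr0 mul0r addr0.
have -> : (3 * N.+1 = (3 * N).+3)%N by rewrite mulnS.
move: IH; rewrite /catalan_sum /series /= => IH.
rewrite !(big_nat_recr (3 * N).+2)//= !(big_nat_recr (3 * N).+1)//=.
rewrite !(big_nat_recr (3 * N))//= !(big_nat_recr N)//=.
have e0 : (2 * (3 * N)).+1%:R = 6 * N%:R + 1 :> R.
  by rewrite -(natr_affine 6 N 1); congr _%:R; lia.
have e1 : (2 * (3 * N).+1).+1%:R = 6 * N%:R + 3 :> R.
  by rewrite -(natr_affine 6 N 3); congr _%:R; lia.
have e2 : (2 * (3 * N).+2).+1%:R = 6 * N%:R + 5 :> R.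
  by rewrite -(natr_affine 6 N 5); congr _%:R; lia.
rewrite !addn1 e0 e1 e2.
have e3 : (2 * N).+1%:R = 2 * N%:R + 1 :> R by rewrite -natr1 natrM.
rewrite e3.
have s0 : sin ((6 * N%:R + 1) * (pi / 6)) = (- 1) ^+ N / 2 :> R.
  have -> : (6 * N%:R + 1) * (pi / 6) = pi / 6 + pi *+ N :> R.
    by rewrite -[pi *+ N]mulr_natl; field.
  by rewrite sin_alternating_pi sin_pi6 div1r.
have s1 : sin ((6 * N%:R + 3) * (pi / 6)) = (- 1) ^+ N :> R.
  have -> : (6 * N%:R + 3) * (pi / 6) = pi / 2 + pi *+ N :> R.
    by rewrite -[pi *+ N]mulr_natl; field.
  by rewrite sin_alternating_pi sin_pihalf mulr1.
have s2 : sin ((6 * N%:R + 5) * (pi / 6)) = (- 1) ^+ N / 2 :> R.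
  have -> : (6 * N%:R + 5) * (pi / 6) = - (pi / 6) + pi *+ N.+1 :> R.
    by rewrite -[pi *+ N.+1]mulr_natl -natr1; field.
  by rewrite sin_alternating_pi sinN sin_pi6 exprS div1r; ring.
rewrite s0 s1 s2 !exprS [in (- 1) ^+ (3 * N)]exprM.
have -> : (- 1) ^+ 3 = - 1 :> R by rewrite -signr_odd.
have n0 : 0 <= N%:R :> R by [].
move: IH; set X := \sum_(0 <= k < 3 * N) sin _ / _.
set Y := \sum_(0 <= k < 3 * N) _; set Z := \sum_(0 <= k < N) _ => IH.
have -> : Y = 2 * X - Z / 3 by rewrite IH; ring.
by field; apply/and4P; split; apply/lt0r_neq0; lra.
Qed.

Lemma clausen2_pi6 :
  clausen2 (pi / 6) + clausen2 (pi - pi / 6) = 4 / 3 * catalan R.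
Proof.
have pig := pi_gt0 R.
have c1 : clausen_sum (pi / 6 : R) @ \oo --> clausen2 (pi / 6).
  by apply: cvg_clausen_sum; apply/andP; split; lra.
have c2 : clausen_sum (pi - pi / 6 : R) @ \oo --> clausen2 (pi - pi / 6).
  by apply: cvg_clausen_sum; apply/andP; split; lra.
have m6 (u : nat -> R) (l : R) : u @ \oo --> l -> u (2 * (3 * N))%N @[N --> \oo] --> l.
  move=> ul; apply: (@cvg_seq_muln (fun N => u (2 * N)%N)) => //.
  exact: cvg_seq_muln.
have H1 : clausen_sum (pi / 6) (2 * (3 * N)) +
    clausen_sum (pi - pi / 6) (2 * (3 * N)) @[N --> \oo]
    --> clausen2 (pi / 6) + clausen2 (pi - pi / 6 : R).
  by apply: cvgD; exact: m6.
have H2 : catalan_sum (3 * N) + catalan_sum N / 3 @[N --> \oo]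
    --> catalan R + catalan R / 3.
  apply: cvgD; first by apply: cvg_seq_muln => //; exact: cvg_catalan_sum.
  by apply: cvgMr_tmp; exact: cvg_catalan_sum.
rewrite (_ : 4 / 3 * _ = catalan R + catalan R / 3); last by field.
move: H1; under eq_fun do rewrite clausen_sum_catalan.
by move=> /(cvg_lim (@Rhausdorff R)) <-; rewrite (cvg_lim (@Rhausdorff R) H2).
Qed.

(** The sine of [2 pi n / 3] is [sqrt 3 / 2] times the character of discriminant -3 at [n]; each
    block of three indices is one term of the series. *)
Lemma clausen_sum_Lm3 N : clausen_sum (pi - pi / 3) (3 * N) = Num.sqrt 3 / 2 *
  series (fun n => 1 / (3 * n + 1)%:R ^+ 2 - 1 / (3 * n + 2)%:R ^+ 2 : R) N.
Proof.
elim: N => [|N IH]; first by rewrite muln0 clausen_sum0 /series /= big_geq// mulr0.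
have -> : (3 * N.+1 = (3 * N).+3)%N by rewrite mulnS.
rewrite !clausen_sum_recr IH /series /= big_nat_recr//= addn1 addn2.
have -> : (3 * N).+3%:R * (pi - pi / 3) = 0 + pi *+ (2 * N.+1) :> R.
  rewrite -[pi *+ _]mulr_natl (_ : (2 * N.+1)%N = (2 * N + 2)%N); last by lia.
  rewrite (_ : (3 * N).+3 = (3 * N + 3)%N); last by lia.
  by rewrite !natr_affine; field.
have -> : (3 * N).+1%:R * (pi - pi / 3) = - (pi / 3) + pi *+ (2 * N).+1 :> R.
  by rewrite -[pi *+ _]mulr_natl -[(3 * N).+1]addn1 -[(2 * N).+1]addn1 !natr_affine; field.
have -> : (3 * N).+2%:R * (pi - pi / 3) = pi / 3 + pi *+ (2 * N).+1 :> R.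
  by rewrite -[pi *+ _]mulr_natl -[(3 * N).+2]addn2 -[(2 * N).+1]addn1 !natr_affine; field.
rewrite !sin_alternating_pi sin0 sinN sin_pi3 exprS exprM sqrrN expr1n expr1n.
by rewrite mulr0 mul0r addr0; ring.
Qed.

(** The first equality is duplication at [x = pi / 3], where [2 x = pi - x] makes the relation close
    up; the second is the limit of [clausen_sum_Lm3]. *)
Lemma clausen2_pi3 :
  clausen2 (pi - pi / 3) = 2 / 3 * clausen2 (pi / 3 : R) /\
  clausen2 (pi - pi / 3) = Num.sqrt 3 / 2 * Lm3 R 2.
Proof.
have pig := pi_gt0 R.
have c1 : clausen_sum (pi / 3 : R) @ \oo --> clausen2 (pi / 3).
  by apply: cvg_clausen_sum; apply/andP; split; lra.
have c2 : clausen_sum (pi - pi / 3 : R) @ \oo --> clausen2 (pi - pi / 3).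
  by apply: cvg_clausen_sum; apply/andP; split; lra.
split.
  have H1 : clausen_sum (pi / 3) (2 * N) - clausen_sum (pi - pi / 3) (2 * N)
      @[N --> \oo] --> clausen2 (pi / 3) - clausen2 (pi - pi / 3 : R).
    by apply: cvgB; exact: cvg_seq_muln.
  have H2 : 2^-1 * clausen_sum (pi - pi / 3 : R) N @[N --> \oo]
      --> 2^-1 * clausen2 (pi - pi / 3).
    by apply: cvgMl_tmp; exact: c2.
  have : clausen2 (pi / 3) - clausen2 (pi - pi / 3)
      = 2^-1 * clausen2 (pi - pi / 3 : R).
    have e : 2 * (pi / 3) = pi - pi / 3 :> R by field.
    move: H1; under eq_fun do rewrite clausen_sum_duplication e.
    move=> /(cvg_lim (@Rhausdorff R)) <-.
    by rewrite (cvg_lim (@Rhausdorff R) H2).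
  lra.
have s0 : Num.sqrt 3 / 2 != 0 :> R.
  by rewrite mulf_neq0// gt_eqF// sqrtr_gt0.
(* The constant is moved to the Clausen side, so that convergence of the [Lm3] series follows from
   that of the Clausen series. *)
have H : (Num.sqrt 3 / 2)^-1 * clausen_sum (pi - pi / 3) (3 * N) @[N --> \oo]
    --> (Num.sqrt 3 / 2)^-1 * clausen2 (pi - pi / 3 : R).
  by apply: cvgMl_tmp; apply: cvg_seq_muln => //; exact: c2.
rewrite /Lm3 (_ : series _ =
  (fun N => (Num.sqrt 3 / 2)^-1 * clausen_sum (pi - pi / 3) (3 * N))).
  by rewrite (cvg_lim (@Rhausdorff R) H) mulrA mulfV// mul1r.
by apply/funext => N; rewrite clausen_sum_Lm3 mulrA mulVf// mul1r.
Qed.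

End ClausenValues.

(** * Evaluation of the Mahler measures *)

Section MahlerIntegrals.
Context {R : realType}.
Implicit Types (a b c g k m t u v w x : R).
Notation mu := (@lebesgue_measure R).

(** Meant for the outer integral: [w] vanishes at some endpoints of the pieces, where
    [inner_integral] gives no value of [F]. Endpoints have measure 0. *)
Lemma integral_eq_interior (F : R -> \bar R) (f : R -> R) a b :
  {in `[a, b], continuous f} -> {in `]a, b[, forall u, F u = (f u)%:E} ->
  measurable_fun `]a, b[ F /\
  (\int[mu]_(u in `[a, b]) F u)%E = (\int[mu]_(u in `[a, b]) f u)%:E.
Proof.
move=> cf Ff.
have intf := integrable_continuous_itv cf.
have mf : measurable_fun `]a, b[ (EFin \o f).
  apply: measurable_funS (measurable_int mu intf) => //.
  exact: subset_itv_oo_cc.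
have mF : measurable_fun `]a, b[ F.
  apply: eq_measurable_fun mf => u; rewrite inE => uab.
  by rewrite Ff.
split => //; rewrite /Rintegral fineK; last exact: integrable_fin_num.
rewrite integral_itv_bndoo// [RHS](@integral_itv_bndoo _ _ _ (EFin \o f))//.
by apply: eq_integral => u; rewrite inE => uab; rewrite Ff.
Qed.

(** Measurability is asked on the open pieces only, which is what [integral_eq_interior] provides;
    adding endpoints preserves it. *)
Lemma integral_itv_concat (F : R -> \bar R) a c b : a <= c <= b ->
  measurable_fun `]a, c[ F -> measurable_fun `]c, b[ F ->
  (\int[mu]_(u in `[a, b]) F u =
   \int[mu]_(u in `[a, c]) F u + \int[mu]_(u in `[c, b]) F u)%E.
Proof.
move=> /andP[ac cb] mac mcb.
have m1 : measurable_fun `[a, c] F := emeasurable_fun_itv_cc mac.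
have m2 : measurable_fun `]c, b] F.
  by apply/emeasurable_fun_itv_bndo_bndcP.
rewrite (@itv_bndbnd_setU _ _ _ (BRight c))//= integral_setU//.
- by rewrite integral_itv_obnd_cbnd.
- exact/measurable_funU.
- apply: lt_disjoint => x y; rewrite !in_itv/= => /andP[_ xc] /andP[cy _].
  exact: le_lt_trans cy.
Qed.

(** * Values of the polynomials on the torus *)

Lemma Re_normc_torus t u v : complex.Re `|torus_pt t * torus_pt u * v%:C%C| = `|v|.
Proof.
have n1 x : `|torus_pt x| = 1 :> R[i].
  by rewrite normc_def /= cos2Dsin2 sqrtr1.
by rewrite !normrM !n1 !mul1r normc_def /= expr0n addr0 sqrtr_sqr.
Qed.

Lemma torus_conj t : torus_pt t * (torus_pt t)^*%C = 1.
Proof. by rewrite -sqr_normc normc_def /= cos2Dsin2 sqrtr1 expr1n. Qed.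

Lemma torus_addJ t : torus_pt t + (torus_pt t)^*%C = (2 * cos (2 * pi * t))%:C%C.
Proof. by rewrite addcJ /= rmorphM /= rmorph_nat. Qed.

(* P(X, Y) / (X Y) on the torus, in terms of x = Re X and y = Re Y. *)
Definition torus_real k x y : R := 2 * y * (2 * x + 2) + (2 * x + k).

(** On the torus inverses are conjugates, so division by the product of the two coordinates leaves a
    real expression in cosines. The coefficient [q] enters through its value [k] alone, so that 6
    and -10 are both covered. *)
Lemma torus_eval (q : {poly {poly R[i]}}) k t u :
  q.[torus_pt t, torus_pt u] = k%:C%C ->
  ('Y ^+ 2 * ('X + 1) ^+ 2 + 'Y * ('X ^+ 2 + q * 'X + 1)
     + ('X + 1) ^+ 2).[torus_pt t, torus_pt u] =
  torus_pt t * torus_pt u *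
    (torus_real k (cos (2 * pi * t)) (cos (2 * pi * u)))%:C%C.
Proof.
move=> qE.
rewrite !(hornerD, hornerM, horner_exp, hornerX, hornerC) qE.
rewrite /torus_real !(rmorphD, rmorphM, rmorph_nat) /=.
have E x : (1%:C%C + 1%:C%C) * (cos (2 * pi * x))%:C%C =
    torus_pt x + (torus_pt x)^*%C.
  by rewrite torus_addJ !(rmorphD, rmorphM).
rewrite !E rmorph1.
have := torus_conj t; have := torus_conj u.
move: (torus_pt t) (torus_pt u) (_^*%C) (_^*%C) (k%:C%C) => X Y X' Y' K h1 h2.
(* The products [X * X'] and [Y * Y'] are left unreduced here: setting them to 1 gives the
   polynomial, expanding the other side gives the real form. *)
transitivity (Y ^+ 2 * (X ^+ 2 + X * X' + 2 * X)
  + Y * Y' * (X ^+ 2 + X * X' + 2 * X) + Y * (X ^+ 2 + X * X' + K * X)).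
  rewrite h1 h2; ring.
ring.
Qed.

Lemma horner2_natr (p : R[i]) (q : R[i]) n :
  (n%:R : {poly {poly R[i]}}).[p, q] = (n%:R)%:C%C.
Proof. by rewrite !hornerMn !hornerC rmorph_nat. Qed.

Lemma torus_real_plus6 x w c : c = 2 * w ^+ 2 - 1 ->
  torus_real 6 x c = (1 + 2 * w) ^+ 2 + (1 - 2 * w) ^+ 2
    - 2 * (1 + 2 * w) * (1 - 2 * w) * x.
Proof. by move=> ->; rewrite /torus_real; ring. Qed.

Lemma torus_real_minus10 x w c k : k ^+ 2 = 3 -> c = 1 - 2 * w ^+ 2 ->
  torus_real (- 10) x c = - ((k + 2 * w) ^+ 2 + (k - 2 * w) ^+ 2
    - 2 * (k + 2 * w) * (k - 2 * w) * x).
Proof.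
move=> k3 ->; transitivity (- (2 * k ^+ 2 + 8 * w ^+ 2
  - 2 * (k ^+ 2 - 4 * w ^+ 2) * x)); last by ring.
by rewrite k3 /torus_real; ring.
Qed.

Lemma inner_integral (P : {poly {poly R[i]}}) k w u : 0 < k -> 0 < w ->
  (forall t, complex.Re `|P.[torus_pt t, torus_pt u]| =
     `|(k + 2 * w) ^+ 2 + (k - 2 * w) ^+ 2
       - 2 * (k + 2 * w) * (k - 2 * w) * cos (2 * pi * t)|) ->
  (\int[mu]_(t in `[0%R, 1%R])
     lne (complex.Re `|P.[torus_pt t, torus_pt u]|)%:E)%E
  = (2 * ln (k + 2 * w))%:E.
Proof.
move=> k0 w0 PE; rewrite -integral_lne_poisson//; apply: eq_integral => t _.
rewrite PE ger0_norm// poisson_factor// mulr_ge0 ?sqr_ge0// ltW//.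
exact: poisson_gt0 (poisson_ratio k0 w0) (cos_max _).
Qed.

Lemma continuous_ln_cos_cos g m a b : 0 < g < pi / 2 ->
  - (pi / 2) <= pi * a + m -> pi * b + m <= pi / 2 ->
  {in `[a, b], continuous (fun u => 2 * ln (2 * cos g + 2 * cos (pi * u + m)))}.
Proof.
move=> /andP[g0 g2] am bm u; rewrite in_itv/= => /andP[au ub].
have pig := pi_gt0 R.
have cg0 : 0 < cos g by apply: cos_gt0_pihalf; apply/andP; split; lra.
have cu0 : 0 <= cos (pi * u + m).
  have h1 := ler_wpM2l (ltW pig) au; have h2 := ler_wpM2l (ltW pig) ub.
  by apply: cos_ge0_pihalf; apply/andP; split; lra.
apply: cvgMl_tmp; apply: continuous_comp; last by apply: continuous_ln; lra.
apply: cvgD; first exact: cvg_cst.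
apply: cvgMl_tmp; apply: continuous_comp; last exact: continuous_cos.
apply: cvgD; last exact: cvg_cst.
by apply: cvgMl_tmp; exact: cvg_id.
Qed.

(** One piece of the outer integral, on which the shift [m] makes [w = cos (pi u + m)] nonnegative.
    The sequence [v] collects the four boundary Clausen sums, so each use only has to reduce angles
    modulo 2 pi. *)
Lemma integral_cos_piece (P : {poly {poly R[i]}}) g m a b (v : nat -> R) (l : R) :
  0 < g < pi / 2 ->
  (forall t u, complex.Re `|P.[torus_pt t, torus_pt u]| =
     `|(2 * cos g + 2 * cos (pi * u + m)) ^+ 2
       + (2 * cos g - 2 * cos (pi * u + m)) ^+ 2
       - 2 * (2 * cos g + 2 * cos (pi * u + m))
           * (2 * cos g - 2 * cos (pi * u + m)) * cos (2 * pi * t)|) ->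
  v @ \oo --> l ->
  a < b -> - (pi / 2) <= pi * a + m -> pi * b + m <= pi / 2 ->
  (forall N, clausen_sum (pi * b + (m + (pi - g))) N
             - clausen_sum (pi * a + (m + (pi - g))) N
             + (clausen_sum (pi * b + (m - (pi - g))) N
             - clausen_sum (pi * a + (m - (pi - g))) N) = - v N) ->
  let F u := (\int[mu]_(t in `[0%R, 1%R])
     lne (complex.Re `|P.[torus_pt t, torus_pt u]|)%:E)%E in
  measurable_fun `]a, b[ F /\
  (\int[mu]_(u in `[a, b]) F u)%E = (2 / pi * l)%:E.
Proof.
move=> g2 PE cl ab am bm vE F.
have cf := continuous_ln_cos_cos g2 am bm.
have [|mF ->] := integral_eq_interior (F := F) cf.
  move=> u; rewrite in_itv/= => /andP[au ub].
  have pig := pi_gt0 R; case/andP: g2 => g0 g2.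
  apply: inner_integral.
  - by rewrite mulr_gt0//; apply: cos_gt0_pihalf; apply/andP; split; lra.
  - have h1 : pi * a < pi * u by rewrite ltr_pM2l.
    have h2 : pi * u < pi * b by rewrite ltr_pM2l.
    by apply: cos_gt0_pihalf; apply/andP; split; lra.
  - by move=> t; rewrite PE.
split => //; congr (_%:E).
have H : 2 / pi * v N @[N --> \oo] --> 2 / pi * l by apply: cvgMl_tmp; exact: cl.
rewrite -(cvg_lim (@Rhausdorff R) H).
move: (cvg_ln_cos_cos ab g2 am bm).
under eq_fun do rewrite -mulrDr vE mulrN !mulNr opprK.
by move=> /(cvg_lim (@Rhausdorff R)) ->.
Qed.

Lemma clausen_sum_neg_mod2pi x y N : x = - y + pi *+ 2 ->
  clausen_sum x N = - clausen_sum y N.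
Proof. by move=> ->; rewrite clausen_sumD2pi clausen_sumN. Qed.

Lemma sqr_cos_half x u m : x = 2 * (pi * u + m) ->
  cos x = 2 * cos (pi * u + m) ^+ 2 - 1.
Proof. by move=> ->; rewrite mulr_natl cos_mulr2n -mulr_natl. Qed.

(** Here [g = pi / 3], and [w = |cos (pi u)|] changes branch at [u = 1/2]: the shift is 0 before and
    [- pi] after. The two pieces contribute equally. *)
Lemma mahler_measure_plus6 :
  mahler_measure ('Y ^+ 2 * ('X + 1) ^+ 2 + 'Y * ('X ^+ 2 + 6 * 'X + 1)
                   + ('X + 1) ^+ 2)
  = (4 / pi * (clausen2 (pi / 6) + clausen2 (pi - pi / 6)))%:E :> \bar R.
Proof.
have pig := pi_gt0 R; have pi0 : pi != 0 :> R by rewrite gt_eqF.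
have c1 : clausen_sum (pi / 6 : R) @ \oo --> clausen2 (pi / 6).
  by apply: cvg_clausen_sum; apply/andP; split; lra.
have c2 : clausen_sum (pi - pi / 6 : R) @ \oo --> clausen2 (pi - pi / 6).
  by apply: cvg_clausen_sum; apply/andP; split; lra.
set P : {poly {poly R[i]}} := (X in mahler_measure X).
have PE m : m = 0 \/ m = - pi -> forall t u, complex.Re `|P.[torus_pt t, torus_pt u]| =
    `|(2 * cos (pi / 3) + 2 * cos (pi * u + m)) ^+ 2
      + (2 * cos (pi / 3) - 2 * cos (pi * u + m)) ^+ 2
      - 2 * (2 * cos (pi / 3) + 2 * cos (pi * u + m))
          * (2 * cos (pi / 3) - 2 * cos (pi * u + m)) * cos (2 * pi * t)|.
  move=> Hm t u; rewrite (torus_eval (horner2_natr _ _ 6)) Re_normc_torus.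
  rewrite cos_pi3 (_ : 2 * (1 / 2) = 1); last by field.
  congr `| _ |; apply: torus_real_plus6; case: Hm => ->.
    by apply: sqr_cos_half; ring.
  rewrite -(@sqr_cos_half (2 * (pi * u - pi)))//.
  rewrite -[RHS](cosD2pin _ 1) mulr1n -[pi *+ 2]mulr_natl.
  by congr cos; ring.
have g3 : 0 < (pi / 3 : R) < pi / 2 by apply/andP; split; lra.
have cv : clausen_sum (pi / 6) N + clausen_sum (pi - pi / 6 : R) N @[N --> \oo]
    --> clausen2 (pi / 6) + clausen2 (pi - pi / 6) by exact: cvgD.
have [|||N|m1 i1] := @integral_cos_piece P (pi / 3) 0 0 (1 / 2) _ _ g3
  (PE _ (or_introl erefl)) cv.
- lra.
- lra.
- lra.
(* At [u = 1/2] the angles are 7 pi/6, congruent to -5 pi/6, and -pi/6. At [u = 0] they are 2 pi/3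
   and -2 pi/3, whose sums cancel by oddness. *)
- rewrite (@clausen_sum_neg_mod2pi _ (pi - pi / 6)); last first.
    by rewrite -[pi *+ 2]mulr_natl; field.
  rewrite (_ : pi * (1 / 2) + _ = - (pi / 6)); last by field.
  rewrite (_ : pi * 0 + (0 - (pi - pi / 3)) = - (pi * 0 + (0 + (pi - pi / 3)))).
    by rewrite !clausen_sumN; ring.
  by ring.
have [|||N|m2 i2] := @integral_cos_piece P (pi / 3) (- pi) (1 / 2) 1 _ _ g3
  (PE _ (or_intror erefl)) cv.
- lra.
- lra.
- lra.
(* Mirror image of the first piece: the cancelling pair now sits at [u = 1], and [u = 1/2] gives
   pi/6 and -7 pi/6, congruent to 5 pi/6. *)
- rewrite -[pi * (1 / 2) + (- pi - _)]opprK [clausen_sum (- - _) N]clausen_sumN.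
  rewrite (@clausen_sum_neg_mod2pi (- (pi * (1 / 2) + _)) (pi - pi / 6)); last first.
    by rewrite -[pi *+ 2]mulr_natl; field.
  rewrite (_ : pi * 1 + (- pi - (pi - pi / 3)) = - (pi * 1 + (- pi + (pi - pi / 3)))); last by ring.
  rewrite (_ : pi * (1 / 2) + _ = pi / 6); last by field.
  by rewrite !clausen_sumN; ring.
rewrite /mahler_measure (@integral_itv_concat _ 0 (1 / 2))//; last first.
  by apply/andP; split; lra.
rewrite i1 i2 -EFinD; congr (_%:E).
by move: (clausen2 _) (clausen2 _) pi0 => p q; move: pi => r r0; field.
Qed.

(** Here [g = pi / 6] and [w = sin (pi u) = cos (pi u - pi / 2)] is nonnegative on all of [[0, 1]],
    so a single piece suffices. *)
Lemma mahler_measure_minus10 :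
  mahler_measure ('Y ^+ 2 * ('X + 1) ^+ 2 + 'Y * ('X ^+ 2 - 10 * 'X + 1)
                   + ('X + 1) ^+ 2)
  = (4 / pi * (clausen2 (pi / 3) + clausen2 (pi - pi / 3)))%:E :> \bar R.
Proof.
have pig := pi_gt0 R; have pi0 : pi != 0 :> R by rewrite gt_eqF.
have c1 : clausen_sum (pi / 3 : R) @ \oo --> clausen2 (pi / 3).
  by apply: cvg_clausen_sum; apply/andP; split; lra.
have c2 : clausen_sum (pi - pi / 3 : R) @ \oo --> clausen2 (pi - pi / 3).
  by apply: cvg_clausen_sum; apply/andP; split; lra.
rewrite -mulNr.
set P : {poly {poly R[i]}} := (X in mahler_measure X).
have PE t u : complex.Re `|P.[torus_pt t, torus_pt u]| =
    `|(2 * cos (pi / 6) + 2 * cos (pi * u - pi / 2)) ^+ 2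
      + (2 * cos (pi / 6) - 2 * cos (pi * u - pi / 2)) ^+ 2
      - 2 * (2 * cos (pi / 6) + 2 * cos (pi * u - pi / 2))
          * (2 * cos (pi / 6) - 2 * cos (pi * u - pi / 2)) * cos (2 * pi * t)|.
  rewrite (@torus_eval _ (- 10)); last first.
    by rewrite !hornerN horner2_natr -rmorphN.
  rewrite Re_normc_torus -normrN; congr `| _ |.
  rewrite (@torus_real_minus10 _ (cos (pi * u - pi / 2)) _ (2 * cos (pi / 6))).
  - by rewrite opprK.
  - rewrite cos_pi6 mulrCA mulfV ?mulr1 ?sqr_sqrtr// pnatr_eq0.
  - rewrite -[RHS]opprB -(@sqr_cos_half (2 * (pi * u - pi / 2)))//.
    by rewrite -cosDpi; congr cos; field.
have g6 : 0 < (pi / 6 : R) < pi / 2 by apply/andP; split; lra.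
have cv : 2 * (clausen_sum (pi / 3) N + clausen_sum (pi - pi / 3 : R) N) @[N --> \oo]
    --> 2 * (clausen2 (pi / 3) + clausen2 (pi - pi / 3)).
  by apply: cvgMl_tmp; exact: cvgD.
have [|||N|m1 i1] := @integral_cos_piece P (pi / 6) (- (pi / 2)) 0 1 _ _ g6 PE cv.
- lra.
- lra.
- lra.
(* Modulo 2 pi the angles are -2 pi/3 and -pi/3 at [u = 1], and pi/3 and 2 pi/3 at [u = 0]; each
   Clausen value occurs twice, hence the factor 2 in [cv]. *)
- rewrite (@clausen_sum_neg_mod2pi (pi * 1 + (- (pi / 2) + _)) (pi - pi / 3)); last first.
    by rewrite -[pi *+ 2]mulr_natl; field.
  rewrite (_ : pi * 0 + (- (pi / 2) + (pi - pi / 6)) = pi / 3); last by field.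
  rewrite (_ : pi * 1 + (- (pi / 2) - (pi - pi / 6)) = - (pi / 3)); last by field.
  rewrite -[pi * 0 + _]opprK [clausen_sum (- - _) N]clausen_sumN.
  rewrite (@clausen_sum_neg_mod2pi (- (pi * 0 + _)) (pi - pi / 3)); last first.
    by rewrite -[pi *+ 2]mulr_natl; field.
  by rewrite !clausen_sumN; ring.
rewrite /mahler_measure i1; congr (_%:E).
by move: (clausen2 _) (clausen2 _) pi0 => p q; move: pi => r r0; field.
Qed.

End MahlerIntegrals.

Theorem theorem10 (R : realType) :
  let x : {poly {poly R[i]}} := 'X in
  let y : {poly {poly R[i]}} := 'Y in
  (mahler_measure (y ^+ 2 * (x + 1) ^+ 2 + y * (x ^+ 2 + 6 * x + 1)
                   + (x + 1) ^+ 2)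
     = (16 / (3 * pi) * Lm4 R 2)%:E
   /\ 16 / (3 * pi) * Lm4 R 2 = 16 / (3 * pi) * catalan R)
  /\
  (mahler_measure (y ^+ 2 * (x + 1) ^+ 2 + y * (x ^+ 2 - 10 * x + 1)
                   + (x + 1) ^+ 2)
     = (5 * Num.sqrt 3 / pi * Lm3 R 2)%:E
   /\ 5 * Num.sqrt 3 / pi * Lm3 R 2 = 20 / (3 * pi) * clausen2 (pi / 3)).
Proof.
have pi0 : pi != 0 :> R by rewrite gt_eqF// pi_gt0.
have [e1 e2] := @clausen2_pi3 R.
have L3 : 5 * Num.sqrt 3 / pi * Lm3 R 2 = 20 / (3 * pi) * clausen2 (pi / 3 : R).
  transitivity (10 / pi * (Num.sqrt 3 / 2 * Lm3 R 2)).
    by move: pi pi0 => p p0; field.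
  by rewrite -e2 e1; move: (clausen2 _) pi0 => c; move: pi => p p0; field.
move=> x y; rewrite /x /y; split; split => //.
  rewrite mahler_measure_plus6 clausen2_pi6; congr (_%:E).
  (* At [s = 2] the two series are the same by definition; the constant is [4 / pi * (4 / 3)]. *)
  rewrite -[Lm4 R 2]/(catalan R).
  by move: (catalan R) pi0 => c; move: pi => p p0; field.
(* The constant comes from [4 / pi * (1 + 2 / 3) = 20 / (3 pi)]. *)
rewrite L3 mahler_measure_minus10 e1; congr (_%:E).
by move: (clausen2 _) pi0 => c; move: pi => p p0; field.
Qed.
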